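(* Let the weighted graph class $\mathcal{A},\tau$ have growth constant $\gamma$, and let $R_n\in_\tau\mathcal{A}$. Let $H$ be a connected graph on vertex set $[h]$ with root vertex $1$, and suppose $H$ is freely attachable to $\mathcal{A}$. Then there exists $\alpha>0$ such that $\Pr[f_H(R_n)\le\alpha n]=e^{-\Omega(n)}$.
   Context: Graph classes are closed under isomorphism; $\mathcal{A}_n$ is the set of graphs in $\mathcal{A}$ on $[n]$. Weighting $\tau=(\lambda,\nu)$, $\lambda,\nu>0$; $\tau(G)=\lambda^{e(G)}\nu^{\kappa(G)}$ ($e$ = edges, $\kappa$ = components); $\tau(\mathcal{A}_n)=\sum_{G\in\mathcal{A}_n}\tau(G)$. $R_n\in_\tau\mathcal{A}$: $\Pr(R_n=G)=\tau(G)/\tau(\mathcal{A}_n)$. Growth constant $\gamma$: $0\le\gamma<\infty$ and $\tau(\mathcal{A}_n)=(\gamma+o(1))^nn!$. A rooted connected graph $H$ with root $r$ is freely attachable to $\mathcal{A}$ if for every $G\in\mathcal{A}$ and vertex $v$ of $G$, the graph obtained from the disjoint union $G\cup H$ by adding the edge $vr$ is in $\mathcal{A}$. For $G$ on $[n]$ with $n>h$ and $W\subseteq V(G)$ with $|W|=h$, let $r_W$ be the least element of $W$; $H$ has a pendant appearance at $W$ in $G$ if the increasing bijection $[h]\to W$ is an isomorphism from $H$ to the induced subgraph $G[W]$, and there is exactly one edge of $G$ between $W$ and $V(G)\setminus W$, this edge being incident with $r_W$. $f_H(G)$ is the number of sets $W$ at which $H$ has a pendant appearance. *)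

(* Defs.v *)
From HB Require Import structures.
From mathcomp Require Import all_boot all_order all_algebra.
From mathcomp Require Import all_classical all_reals all_analysis.

Set Implicit Arguments.
Unset Strict Implicit.
Unset Printing Implicit Defensive.

Import Order.TTheory GRing.Theory Num.Theory.
Import numFieldNormedType.Exports.

Local Open Scope ring_scope.

Record sgraph (T : finType) := SGraph {
  edges :> {set {set T}};
  edges_card2 : [forall e in edges, #|e| == 2%N] }.

HB.instance Definition _ (T : finType) := [isSub for @edges T].
HB.instance Definition _ (T : finType) := [Finite of sgraph T by <:].

Definition adj (T : finType) (G : sgraph T) : rel T :=
  fun x y => [set x; y] \in edges G.

Definition num_edges (T : finType) (G : sgraph T) : nat := #|edges G|.

Definition num_comps (T : finType) (G : sgraph T) : nat :=
  n_comp (adj G) T.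

Definition connected_graph (T : finType) (G : sgraph T) : Prop :=
  (0 < #|T|)%N /\ forall x y : T, connect (adj G) x y.

Definition graph_iso (T U : finType) (G : sgraph T) (G' : sgraph U) : Prop :=
  exists2 f : T -> U, bijective f & forall x y, adj G' (f x) (f y) = adj G x y.

Definition graph_family : Type := forall T : finType, pred (sgraph T).

Definition iso_closed (A : graph_family) : Prop :=
  forall (T U : finType) (G : sgraph T) (G' : sgraph U),
    graph_iso G G' -> A T G -> A U G'.

Definition attach_edges (T U : finType) (G : sgraph T) (v : T)
    (H : sgraph U) (r : U) : {set {set T + U}} :=
  [set inl v; inr r] |:
    ([set inl @: e | e : {set T} in edges G] :|:
     [set inr @: e | e : {set U} in edges H]).

Lemma attach_edges_card2 (T U : finType) (G : sgraph T) (v : T)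
    (H : sgraph U) (r : U) :
  [forall e in attach_edges G v H r, #|e| == 2%N].
Proof.
apply/forall_inP => e; rewrite !inE => /orP[/eqP ->|].
  by rewrite cards2.
case/orP => /imsetP[e' e'in ->]; rewrite card_imset.
- exact: (forall_inP (edges_card2 G)).
- by move=> x y [].
- exact: (forall_inP (edges_card2 H)).
- by move=> x y [].
Qed.

Definition attach (T U : finType) (G : sgraph T) (v : T)
    (H : sgraph U) (r : U) : sgraph (T + U)%type :=
  SGraph (attach_edges_card2 G v H r).

Definition freely_attachable (A : graph_family) (U : finType)
    (H : sgraph U) (r : U) : Prop :=
  forall (T : finType) (G : sgraph T) (v : T),
    A T G -> A (T + U)%type (attach G v H r).

Section Weighting.
Variables (R : realType) (A : graph_family) (lambda nu : R).

Definition tau (T : finType) (G : sgraph T) : R :=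
  lambda ^+ num_edges G * nu ^+ num_comps G.

Definition tau_class (n : nat) : R := \sum_(G : sgraph 'I_n | A G) tau G.

Definition growth_constant (gamma : R) : Prop :=
  0 <= gamma /\
  exists2 eps : nat -> R, (eps @ \oo --> (0%R : R))%classic &
    \forall n \near \oo%classic, tau_class n = (gamma + eps n) ^+ n * n`!%:R.

(* The law of the random graph on 'I_n. If no graph on 'I_n lies in A, the
   random graph is undefined and this is identically 0. *)
Definition tau_law (n : nat) (G : sgraph 'I_n) : R :=
  if A G then tau G / tau_class n else 0.

Definition tau_prob (n : nat) (E : pred (sgraph 'I_n)) : R :=
  \sum_(G : sgraph 'I_n | E G) tau_law G.

End Weighting.

Section Pendant.
Variables (h : nat) (H : sgraph 'I_h) (n : nat) (G : sgraph 'I_n).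

Definition induced_copy (W : {set 'I_n}) : bool :=
  [exists phi : {ffun 'I_h -> 'I_n},
    [&& [forall i : 'I_h, forall j : 'I_h, (i < j)%N ==> (phi i < phi j)%N],
        [set phi i | i : 'I_h] == W &
        [forall i : 'I_h, forall j : 'I_h, adj G (phi i) (phi j) == adj H i j]]].

Definition edge_boundary (W : {set 'I_n}) : {set {set 'I_n}} :=
  [set e in edges G | (e :&: W != finset.set0) && (e :&: ~: W != finset.set0)].

Definition is_least (W : {set 'I_n}) (r : 'I_n) : bool :=
  (r \in W) && [forall w in W, (r <= w)%N].

(* For n <= h there is no such W: a set of h vertices then has no edge
   leaving it. *)
Definition pendant_at (W : {set 'I_n}) : bool :=
  [&& #|W| == h, induced_copy W, #|edge_boundary W| == 1%N &
      [exists r : 'I_n, is_least W r &&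
                        [forall e in edge_boundary W, r \in e]]].

Definition pendant_count : nat := #|[set W : {set 'I_n} | pendant_at W]|.

End Pendant.

Definition exp_neg_Omega (R : realType) (u : nat -> R) : Prop :=
  exists2 c : R, 0 < c & \forall n \near \oo%classic, u n <= expR (- (c * n%:R)).

(* Main.v *)
Require Import Defs.
From HB Require Import structures.
From mathcomp Require Import all_boot all_order all_algebra.
From mathcomp Require Import all_classical all_reals all_analysis.
From mathcomp Require Import ring lra.

(* Attaching a copy of H through its root to any vertex of a graph G of the
   class with at most k pendant appearances yields a graph with at most
   k + (h+1)^2 of them: a pendant appearance is determined by its bridge (root,
   outer neighbour), and it is already one of G unless both ends of the bridge
   lie in the new copy or at the attachment vertex.  Let T n k be the weight of
   the graphs of order n with at most k pendant appearances.  The result of the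
   attachment together with the new block W determines G and the attachment
   vertex, and each result contains at most k + (h+1)^2 possible blocks, so
     T n k * binomial(n+h, h) * n * lambda^(e(H)+1)
       <= T (n+h) (k + (h+1)^2) * (k + (h+1)^2).
   Iterating m = k = floor(alpha n) times multiplies the weight by at least
   (n+mh)!/n! * (const/alpha)^m, while the total weight only grows by
   (gamma+o(1))^(mh) e^(o(n)) (n+mh)!/n!; for small alpha this forces T n k to
   be exponentially small.  The same recursion with a fixed ratio shows that
   gamma = 0 is only possible if the class has no graph with a vertex. *)

Set Implicit Arguments.
Unset Strict Implicit.
Unset Printing Implicit Defensive.

Import Order.TTheory GRing.Theory Num.Theory.
Import numFieldNormedType.Exports.

Local Open Scope ring_scope.

(** * Graphs determined by their adjacency relation *)

Lemma adjC (T : finType) (G : sgraph T) : symmetric (adj G).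
Proof. by move=> x y; rewrite /adj finset.setUC. Qed.

Lemma connect_adjC (T : finType) (G : sgraph T) : connect_sym (adj G).
Proof. by apply: sym_connect_sym; apply: adjC. Qed.

Lemma sgraph_edgeP (T : finType) (G : sgraph T) (e : {set T}) :
  reflect (exists x y, e = [set x; y] /\ adj G x y) (e \in edges G).
Proof.
apply: (iffP idP) => [eG|[x [y [-> //]]]].
have /cards2P[x [y [_ e_xy]]] := forall_inP (edges_card2 G) e eG.
by exists x, y; split=> //; rewrite /adj -e_xy.
Qed.

Lemma sgraph_adj_inj (T : finType) (G G' : sgraph T) :
  adj G =2 adj G' -> G = G'.
Proof.
move=> adjE; apply: val_inj => /=; apply/finset.setP => e.
apply/sgraph_edgeP/sgraph_edgeP => -[x [y [e_xy xy]]]; exists x, y.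
  by rewrite -adjE.
by rewrite adjE.
Qed.

(** * Adjacency, edges and components of an attachment *)

Section Attach.
Variables (T U : finType) (G : sgraph T) (v : T) (H : sgraph U) (r : U).

Let inl_inj : injective (@inl T U). Proof. by move=> ? ? []. Qed.
Let inr_inj : injective (@inr T U). Proof. by move=> ? ? []. Qed.

Lemma adj_attach (x y : T + U) : adj (attach G v H r) x y =
  match x, y with
  | inl a, inl b => adj G a b
  | inr a, inr b => adj H a b
  | inl a, inr b => (a == v) && (b == r)
  | inr a, inl b => (b == v) && (a == r)
  end.
Proof.
rewrite /adj !inE.
have lrE a b : [set inl a; inr b] == [set inl v; inr r] :> {set T + U}
    = (a == v) && (b == r).
  apply/eqP/andP => [E|[/eqP-> /eqP->] //]; split.
    by have := finset.set21 (inl a) (inr b : T + U);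
      rewrite E !inE => /orP[/eqP[->]|].
  by have := finset.set22 (inl a) (inr b : T + U);
    rewrite E !inE => /orP[|/eqP[->]].
have lrN a b : ([set inl a; inr b] \in [set inl @: e | e : {set T} in edges G])
    || ([set inl a; inr b] \in [set inr @: e | e : {set U} in edges H]) = false.
  apply/negP => /orP[] /imsetP[e _ E].
    by have := finset.set22 (inl a) (inr b : T + U); rewrite E => /imsetP[].
  by have := finset.set21 (inl a) (inr b : T + U); rewrite E => /imsetP[].
have imset2 (A B : finType) (f : A -> B) (a b : A) :
    [set f a; f b] = f @: [set a; b].
  by rewrite imsetU1 imset_set1.
case: x y => [a|a] [b|b].
- rewrite !imset2 (mem_imset _ _ (imset_inj inl_inj)).
  set b1 := (_ == _); set b2 := (X in _ || (_ || X)).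
  suff [-> ->] : b1 = false /\ b2 = false by rewrite orbF.
  split; apply/negP.
    move/eqP => E; have := finset.set22 (inl v) (inr r : T + U).
    by rewrite -E => /imsetP[].
  case/imsetP => e _ E.
  have : inl a \in ([set inl x | x in [set a; b]] : {set T + U}).
    by apply: imset_f; rewrite !inE eqxx.
  by rewrite E => /imsetP[].
- by rewrite lrE lrN orbF.
- by rewrite finset.setUC lrE lrN orbF.
rewrite !imset2 (mem_imset _ _ (imset_inj inr_inj)).
set b1 := (_ == _); set b2 := (X in _ || (X || _)).
suff [-> ->] : b1 = false /\ b2 = false by [].
split; apply/negP.
  move/eqP => E; have := finset.set21 (inl v) (inr r : T + U).
  by rewrite -E => /imsetP[].
case/imsetP => e _ E.
have : inr a \in ([set inr x | x in [set a; b]] : {set T + U}).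
  by apply: imset_f; rewrite !inE eqxx.
by rewrite E => /imsetP[].
Qed.

Lemma num_edges_attach :
  num_edges (attach G v H r) = (num_edges G + num_edges H).+1.
Proof.
rewrite /num_edges /= /attach_edges cardsU1 cardsU.
rewrite !card_imset; try exact: imset_inj.
set X := (_ \notin _); suff [-> ->] : X = true /\ #|
  [set inl @: e | e : {set T} in edges G]
  :&: [set inr @: e | e : {set U} in edges H]| = 0%N.
  by rewrite subn0.
split.
  rewrite /X inE; apply/negP => /orP[] /imsetP[e _ E].
    by have := finset.set22 (inl v) (inr r : T + U); rewrite E => /imsetP[].
  by have := finset.set21 (inl v) (inr r : T + U); rewrite E => /imsetP[].
apply/eqP; rewrite cards_eq0; apply/eqP/finset.setP => e; rewrite !inE.
apply/negP => /andP[/imsetP[e1 /sgraph_edgeP[x [y [-> _]]] ->]].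
case/imsetP => e2 _ E.
have : inl x \in ([set inl z | z in [set x; y]] : {set T + U}).
  by apply: imset_f; rewrite !inE eqxx.
by rewrite E => /imsetP[].
Qed.

Hypothesis Hconn : connected_graph H.

(** Every vertex of the connected copy reaches [v] through the root, so the copy joins the component
    of [v] and creates none. Formally, [inl] is an adjunction between the two connectivity
    relations. *)
Lemma num_comps_attach : num_comps (attach G v H r) = num_comps G.
Proof.
have adjE := adj_attach.
rewrite /num_comps (adjunction_n_comp (@inl T U) (connect_adjC _)
  (connect_adjC G)) //.
split=> [[x|u] _|x y _].
- by exists x; apply: connect0.
- exists v; apply: (@connect_trans _ _ (inr r)).
    have /connectP[p] := Hconn.2 u r.
    elim: p u => [|w p IHp] u /=; first by move=> _ ->; apply: connect0.
    case/andP => uw /IHp{}IHp /IHp; apply: connect_trans.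
    by apply: connect1; rewrite adjE.
  by apply: connect1; rewrite adjE !eqxx.
(* Collapsing the copy onto [v] turns a path of the attachment into a walk of [G] that may pause at
   [v]. *)
pose pr (z : T + U) := if z is inl a then a else v.
apply/idP/idP => /connectP[p].
  elim: p x => [|w p IHp] x /=; first by move=> _ ->; apply: connect0.
  case/andP => xw /IHp{}IHp /IHp; apply: connect_trans.
  by apply: connect1; rewrite adjE.
move=> xp yp; change (connect (adj G) (pr (inl x)) (pr (inl y))).
elim: p (inl x) xp yp => [|w p IHp] z /=; first by move=> _ <-; apply: connect0.
case/andP => zw /IHp{}IHp /IHp; apply: connect_trans.
move: zw; rewrite adjE; case: z w {IHp} => [a|a] [b|b] /=.
- by move/connect1.
- by case/andP => /eqP -> _; apply: connect0.
- by case/andP => /eqP -> _; apply: connect0.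
- by move=> _; apply: connect0.
Qed.

End Attach.

(** * Transport of graphs along bijections *)

Section Relabel.
Variables (T U : finType) (f : T -> U).

(* The cardinality filter discards the edges collapsed by a non-injective f. *)
Definition relabel_edges (G : sgraph T) : {set {set U}} :=
  [set e in [set f @: e | e : {set T} in edges G] | #|e| == 2%N].

Lemma relabel_edges_card2 (G : sgraph T) :
  [forall e in relabel_edges G, #|e| == 2%N].
Proof. by apply/forall_inP => e; rewrite inE => /andP[]. Qed.

Definition relabel (G : sgraph T) : sgraph U := SGraph (relabel_edges_card2 G).

Hypothesis f_bij : bijective f.
Let f_inj : injective f := bij_inj f_bij.

Lemma relabel_edgesE (G : sgraph T) :
  edges (relabel G) = [set f @: e | e : {set T} in edges G].
Proof.
apply/finset.setP => e; rewrite inE andb_idr // => /imsetP[e' e'G ->].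
by rewrite card_imset // (forall_inP (edges_card2 G)).
Qed.

Lemma adj_relabel (G : sgraph T) (x y : T) :
  adj (relabel G) (f x) (f y) = adj G x y.
Proof.
rewrite /adj relabel_edgesE.
have -> : [set f x; f y] = f @: [set x; y] by rewrite imsetU1 imset_set1.
exact: mem_imset (imset_inj f_inj).
Qed.

Lemma relabel_iso (G : sgraph T) : graph_iso G (relabel G).
Proof. by exists f => // x y; apply: adj_relabel. Qed.

Lemma num_edges_relabel (G : sgraph T) : num_edges (relabel G) = num_edges G.
Proof.
by rewrite /num_edges relabel_edgesE card_imset //; apply: imset_inj.
Qed.

Lemma num_comps_relabel (G : sgraph T) : num_comps (relabel G) = num_comps G.
Proof.
have [g fK gK] := f_bij.
have adjg x y : adj G (g x) (g y) = adj (relabel G) x y.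
  by rewrite -adj_relabel !gK.
rewrite /num_comps (adjunction_n_comp f (connect_adjC _) (connect_adjC G)) //.
apply: strict_adjunction => //.
- exact: connect_adjC.
- by apply/fintype.subsetP => x _; rewrite -[x]gK; apply: codom_f.
- by move=> x y _; apply: adj_relabel.
Qed.

End Relabel.

(** * Pendant appearances and their bridges *)

Section Pendant.
Variables (h : nat) (h_gt0 : (0 < h)%N) (H : sgraph 'I_h).
Hypothesis Hconn : connected_graph H.
Let root := Ordinal h_gt0.

(** A pendant appearance with its embedding and outer neighbour made explicit. The last clause says
    both that one edge leaves [W] and that it starts at the root; the root is the least element of
    [W] because [phi] is increasing and [root] is 0. *)
Definition pendant_copy (n : nat) (G : sgraph 'I_n) (W : {set 'I_n})
    (phi : 'I_h -> 'I_n) (v : 'I_n) : Prop :=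
  [/\ {homo phi : i j / (i < j)%N}, [set phi i | i : 'I_h] = W,
      forall i j, adj G (phi i) (phi j) = adj H i j, v \notin W &
      forall x y, x \in W -> y \notin W ->
        adj G x y = (x == phi root) && (y == v)].

Lemma homo_ltn_ord_inj (m n : nat) (phi : 'I_m -> 'I_n) :
  {homo phi : i j / (i < j)%N} -> injective phi.
Proof.
move=> inc i j E; apply: val_inj; have [/inc|/inc|//] := ltngtP i j;
  by rewrite E ltnn.
Qed.

Lemma edge_boundaryP (n : nat) (G : sgraph 'I_n) (W e : {set 'I_n}) :
  reflect (exists x y, [/\ x \in W, y \notin W, e = [set x; y] & adj G x y])
    (e \in edge_boundary G W).
Proof.
apply: (iffP idP); last first.
  move=> [x [y [xW yW -> xy]]]; rewrite inE; apply/and3P; split=> //.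
    by apply/set0Pn; exists x; rewrite !inE eqxx.
  by apply/set0Pn; exists y; rewrite !inE eqxx orbT.
rewrite inE => /and3P[/sgraph_edgeP[x [y [-> xy]]]].
move=> /set0Pn[a] /[!inE] /andP[/orP[] /eqP -> aW].
  move=> /set0Pn[b] /[!inE] /andP[/orP[] /eqP -> bW]; first by rewrite aW in bW.
  by exists x, y.
move=> /set0Pn[b] /[!inE] /andP[/orP[] /eqP -> bW]; last by rewrite aW in bW.
by exists y, x; split; rewrite 1?finset.setUC 1?adjC.
Qed.

Lemma set2_crossing (T : finType) (W : {set T}) (x y r v : T) :
  x \in W -> y \notin W -> r \in W -> v \notin W ->
  [set x; y] = [set r; v] -> x = r /\ y = v.
Proof.
move=> xW yW rW vW E; have xE : x \in [set r; v] by rewrite -E !inE eqxx.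
have yE : y \in [set r; v] by rewrite -E !inE eqxx orbT.
move: xE yE; rewrite !inE => /orP[] /eqP xr /orP[] /eqP yv; split=> //.
- by rewrite yv rW in yW.
- by rewrite xr (negPf vW) in xW.
- by rewrite xr (negPf vW) in xW.
- by rewrite xr (negPf vW) in xW.
Qed.

Lemma pendant_atP (n : nat) (G : sgraph 'I_n) (W : {set 'I_n}) :
  reflect (exists phi v, pendant_copy G W phi v) (pendant_at H G W).
Proof.
apply: (iffP idP) => [|[phi [v [inc im adjE vW cross]]]]; last first.
  have rW : phi root \in W by rewrite -im imset_f.
  have bdE : edge_boundary G W = [set [set phi root; v]].
    apply/finset.setP => e; rewrite finset.in_set1.
    apply/edge_boundaryP/eqP => [|->].
      move=> [x [y [xW yW -> ]]]; rewrite cross //.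
      by move=> /andP[/eqP -> /eqP ->].
    by exists (phi root), v; rewrite cross // !eqxx.
  apply/and4P; split.
  - by rewrite -im card_imset ?card_ord //; apply: homo_ltn_ord_inj.
  - apply/existsP; exists (finfun phi); apply/and3P; split.
    + apply/forallP => i; apply/forallP => j; apply/implyP.
      by rewrite !ffunE; apply: inc.
    + by apply/eqP; rewrite -[in RHS]im; apply: eq_imset => i; rewrite ffunE.
    + by apply/forallP => i; apply/forallP => j; rewrite !ffunE adjE.
  - by rewrite bdE cards1.
  - apply/existsP; exists (phi root); rewrite bdE /is_least rW /=.
    apply/andP; split; last first.
      by apply/forall_inP => e /[!inE] /eqP ->; rewrite !inE eqxx.
    apply/forall_inP => w; rewrite -im => /imsetP[i _ ->].
    have [i0|i0] := posnP i; last exact: ltnW (inc root i i0).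
    by have -> : i = root by apply: val_inj.
case/and4P => _ /existsP[phi /and3P[/forallP inc /eqP im /forallP adjE]].
case/cards1P => e bdE /existsP[r].
case/andP => /andP[rW /forall_inP least] /forall_inP.
rewrite bdE => /(_ e (finset.set11 e)) re.
have := finset.set11 e; rewrite -bdE => /edge_boundaryP[x [v [xW vW exv xv]]].
have {x xW exv xv re}[exv xv] : e = [set r; v] /\ adj G r v.
  move: re; rewrite exv !inE => /orP[/eqP->|/eqP rv]; first by split.
  by rewrite rv (negPf vW) in rW.
have {}inc : {homo phi : i j / (i < j)%N}.
  by move=> i j; apply/implyP; apply: (forallP (inc i)).
have phir : phi root = r.
  move: (rW); rewrite -im => /imsetP[i _ ri].
  have [i0|i0] := posnP i; first by rewrite ri; congr (phi _); apply: val_inj.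
  have := inc root i i0; rewrite -ri ltnNge least // -im.
  exact: imset_f.
exists phi, v; split=> //.
  by move=> i j; apply/eqP; apply: (forallP (adjE i)).
move=> x y xW yW; rewrite phir; apply/idP/andP => [xy|[/eqP-> /eqP->] //].
have : [set x; y] \in edge_boundary G W by apply/edge_boundaryP; exists x, y.
rewrite bdE exv inE => /eqP E.
by have [-> ->] := set2_crossing xW yW rW vW E.
Qed.

Lemma connected_imset_sub (n : nat) (phi : 'I_h -> 'I_n) (S : {set 'I_n}) i0 :
  phi i0 \in S ->
  (forall i j, adj H i j -> phi i \in S -> phi j \in S) ->
  [set phi i | i : 'I_h] \subset S.
Proof.
move=> i0S closedS; apply/fintype.subsetP => _ /imsetP[j _ ->].
have /connectP[p] := Hconn.2 i0 j.
elim: p i0 i0S => [|k p IHp] i iS /=; first by move=> _ ->.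
by case/andP => /closedS/(_ iS) kS; apply: IHp.
Qed.

(** The bridge is oriented, with [r] inside [W] and [v] outside; the orientation is what makes it
    determine [W]. *)
Definition pendant_via (n : nat) (G : sgraph 'I_n) (W : {set 'I_n})
    (r v : 'I_n) : bool :=
  [&& pendant_at H G W, r \in W, v \notin W & adj G r v].

(* H is connected, so W can only be left through the bridge rv. *)
Lemma pendant_via_inj (n : nat) (G : sgraph 'I_n) (W W' : {set 'I_n}) r v :
  pendant_via G W r v -> pendant_via G W' r v -> W = W'.
Proof.
wlog suff sub : W W' /
    pendant_via G W r v -> pendant_via G W' r v -> W \subset W'.
  by move=> V V'; apply/eqP; rewrite finset.eqEsubset !sub.
case/and4P => /pendant_atP[phi [u [_ im adjE _ cross]]] rW vW rv.
case/and4P => /pendant_atP[phi' [u' [_ _ _ _ cross']]] rW' vW' rv'.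
have /andP[/eqP rE _] : (r == phi root) && (v == u) by rewrite -cross.
have /andP[_ /eqP vE] : (r == phi' root) && (v == u') by rewrite -cross'.
rewrite -im; apply: (@connected_imset_sub _ _ _ root); first by rewrite -rE.
move=> i j ij iW'; apply/negPn/negP => jW'.
move: ij; rewrite -adjE cross' // -vE => /andP[_ /eqP jv].
by move: vW; rewrite -jv -im imset_f.
Qed.

(** An appearance is recovered from its oriented bridge, so appearances with both bridge ends in [X]
    are at most as many as ordered pairs from [X]. *)
Lemma card_pendant_via (n : nat) (G : sgraph 'I_n) (X : {set 'I_n}) :
  (#|[set W | [exists p in finset.setX X X, pendant_via G W p.1 p.2]]|
    <= #|X| ^ 2)%N.
Proof.
set P := [set W | _].
(* The partial inverse from bridges to appearances; by [pendant_via_inj] the set picked is the only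
   candidate. *)
pose Q (p : 'I_n * 'I_n) := [pick W | pendant_via G W p.1 p.2].
have -> : #|P| = #|Some @: P| by rewrite card_imset //; apply: Some_inj.
rewrite expnS expn1 -cardsX; apply: leq_trans (leq_imset_card Q _).
apply/subset_leq_card/fintype.subsetP => _ /imsetP[W WP ->].
move: WP; rewrite inE => /exists_inP[p pX Wp].
apply/imsetP; exists p => //; rewrite /Q; case: pickP => [W' W'p|/(_ W)].
  by rewrite (pendant_via_inj Wp W'p).
by rewrite Wp.
Qed.

(** * Effect of gluing a copy of [H] on the pendant appearances *)

Section Glue.
Variables (n N : nat) (f : 'I_n + 'I_h -> 'I_N) (G : sgraph 'I_n) (v : 'I_n).
Hypothesis f_bij : bijective f.
Hypothesis f_inl : {homo (f \o inl) : i j / (i < j)%N}.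
Hypothesis f_inr : {homo (f \o inr) : i j / (i < j)%N}.

Let G' := relabel f (attach G v H root).
Let B := [set f (inr i) | i : 'I_h].
Let f_inj : injective f := bij_inj f_bij.

Let mem_inl a : (f (inl a) \in B) = false.
Proof. by apply/negP => /imsetP[i _ /f_inj]. Qed.

Let mem_inr i : f (inr i) \in B.
Proof. by apply/imsetP; exists i. Qed.

Lemma pendant_at_glue : pendant_at H G' B.
Proof.
have [g fK gK] := f_bij.
apply/pendant_atP; exists (f \o inr), (f (inl v)); split=> //.
- by move=> i j; rewrite adj_relabel // adj_attach.
- by rewrite mem_inl.
move=> x y; rewrite -[x]gK -[y]gK.
case: (g x) => [a|i]; case: (g y) => [b|j]; rewrite ?mem_inl ?mem_inr // => _ _.
by rewrite adj_relabel // adj_attach !(inj_eq f_inj) andbC.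
Qed.

(** Appearances whose bridge lies in the new copy together with the attachment vertex are counted by
    their bridges. Any other appearance avoids the copy and is the lift of an appearance in [G]. *)
Lemma pendant_count_glue :
  (pendant_count H G' <= pendant_count H G + h.+1 ^ 2)%N.
Proof.
have [g fK gK] := f_bij.
pose X := f (inl v) |: B.
have cardX : (#|X| <= h.+1)%N.
  rewrite cardsU1 -[X in (_ <= X)%N]add1n leq_add ?leq_b1 //.
  by rewrite (leq_trans (leq_imset_card _ _)) ?card_ord.
pose lift (W : {set 'I_n}) := [set f (inl a) | a in W].
pose old := [set lift W | W in [set W | pendant_at H G W]].
pose new := [set W | [exists p in finset.setX X X, pendant_via G' W p.1 p.2]].
suff sub : [set W | pendant_at H G' W] \subset old :|: new.
  apply: leq_trans (subset_leq_card sub) _.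
  apply: leq_trans (leq_card_setU _ _) _; apply: leq_add.
    exact: leq_imset_card.
  apply: leq_trans (card_pendant_via _ _) _.
  by rewrite leq_exp2r.
apply/fintype.subsetP => W /[!inE] W_pend.
have /pendant_atP[phi [u [inc im adjE uW cross]]] := W_pend.
have rW : phi root \in W by rewrite -im imset_f.
have ru : adj G' (phi root) u by rewrite cross // !eqxx.
have [/andP[rX uX]|rXuX] := boolP ((phi root \in X) && (u \in X)).
  apply/orP; right; apply/exists_inP; exists (phi root, u).
    by rewrite finset.in_setX rX uX.
  by rewrite /pendant_via W_pend rW uW.
apply/orP; left.
(* An edge meeting the copy either lies inside it or is the bridge of the copy, so both its ends are
   in [X]. Hence the bridge of [W] joins two old vertices. *)
have [a [b [aE bE]]] : exists a b, phi root = f (inl a) /\ u = f (inl b).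
  move: ru rXuX; rewrite -[phi root]gK -[u]gK /X.
  case: (g (phi root)) => [a|i]; case: (g u) => [b|j].
  - by exists a, b.
  - rewrite adj_relabel // adj_attach !inE mem_inr orbT andbT.
    by case/andP => /eqP ->; rewrite eqxx.
  - rewrite adj_relabel // adj_attach !inE mem_inr orbT.
    by case/andP => /eqP ->; rewrite eqxx.
  - by rewrite !inE !mem_inr !orbT.
(* The edge leaving [W] ends at an old vertex, so no edge of the copy leaves [W]. If [W] met the
   connected copy it would contain it, hence equal it by cardinality, although the root of [W] is
   old. *)
have phiNB i : phi i \notin B.
  apply/negP => /imsetP[j _ phij].
  have jW : f (inr j) \in W by rewrite -phij -im imset_f.
  have BW : B \subset W.
    apply: (connected_imset_sub (phi := f \o inr) jW) => k l kl kW.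
    apply/negPn/negP => lW; have := cross _ _ kW lW.
    rewrite adj_relabel // adj_attach kl bE (inj_eq f_inj).
    by rewrite andbF.
  have cardW : #|W| = #|B|.
    rewrite -im !card_imset //; last exact: homo_ltn_ord_inj.
    by move=> k l /f_inj [].
  have /eqP BWE : B == W by rewrite eqEcard BW cardW leqnn.
  by move: rW; rewrite -BWE aE mem_inl.
(* The default [a] is never taken, since [phi i] is outside the copy. *)
pose psi i := if g (phi i) is inl c then c else a.
have psiE i : f (inl (psi i)) = phi i.
  move: (phiNB i); rewrite /psi -[in X in X -> _](gK (phi i)) -[RHS]gK.
  by case: (g (phi i)) => [//|j]; rewrite mem_inr.
have inl_mono (i j : 'I_n) : (f (inl i) < f (inl j))%N = (i < j)%N.
  apply/idP/idP; last exact: f_inl.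
  have [//|ji|/val_inj->] := ltngtP i j; last by rewrite ltnn.
  by rewrite ltnNge ltnW // (f_inl ji).
have liftE : lift [set psi i | i : 'I_h] = W.
  by rewrite /lift -imset_comp -im; apply: eq_imset => i /=; rewrite psiE.
have mem_lift (S : {set 'I_n}) c : (f (inl c) \in lift S) = (c \in S).
  by rewrite mem_imset // => k l /f_inj [].
apply/imsetP; exists [set psi i | i : 'I_h]; last by rewrite liftE.
rewrite inE; apply/pendant_atP; exists psi, b; split=> //.
- by move=> i j ij; rewrite -inl_mono !psiE; apply: inc.
- move=> i j; rewrite -adjE -!psiE adj_relabel //.
  by rewrite adj_attach.
- by rewrite -mem_lift liftE -bE.
move=> x y; rewrite -!mem_lift liftE => xW yW; have := cross _ _ xW yW.
rewrite adj_relabel // adj_attach => ->.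
by rewrite -psiE bE !(inj_eq f_inj).
Qed.

End Glue.
End Pendant.

(** * Order-preserving placement of the old vertices and the new block *)

Section Place.
Variables (n h : nat).
Implicit Types (W : {set 'I_(n + h)}) (x : 'I_n + 'I_h).

Lemma enum_ord_sorted (N : nat) (S : {set 'I_N}) :
  sorted (fun i j : 'I_N => (i < j)%N) (enum S).
Proof.
apply: sorted_filter; first by move=> ? ? ?; apply: ltn_trans.
by have := iota_ltn_sorted 0 N; rewrite -val_enum_ord sorted_map enumT.
Qed.

(* For #|W| = h these are the increasing bijections of 'I_n onto the
   complement of W and of 'I_h onto W; the defaults of nth are junk. *)
Definition place W x : 'I_(n + h) :=
  match x with
  | inl i => nth (lshift h i) (enum (finset.setC W)) i
  | inr j => nth (rshift n j) (enum W) j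
  end.

Variable W : {set 'I_(n + h)}.
Hypothesis cardW : #|W| = h.

Let cardWC : #|finset.setC W| = n.
Proof. by apply/eqP; rewrite -(eqn_add2l #|W|) cardsC cardW card_ord addnC. Qed.

Lemma place_inl_homo : {homo (place W \o inl) : i j / (i < j)%N}.
Proof.
move=> i j ij; rewrite /= (set_nth_default (lshift h j)) -?cardE ?cardWC //.
have := @sorted_ltn_nth _ _ _ (lshift h j) _ (enum_ord_sorted (finset.setC W)).
by apply=> //; rewrite ?inE -?cardE ?cardWC //; move=> ? ? ?; apply: ltn_trans.
Qed.

Lemma place_inr_homo : {homo (place W \o inr) : i j / (i < j)%N}.
Proof.
move=> i j ij; rewrite /= (set_nth_default (rshift n j)) -?cardE ?cardW //.
have := @sorted_ltn_nth _ _ _ (rshift n j) _ (enum_ord_sorted W).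
by apply=> //; rewrite ?inE -?cardE ?cardW //; move=> ? ? ?; apply: ltn_trans.
Qed.

Lemma place_inl i : (place W (inl i) \in W) = false.
Proof.
apply/negbTE; rewrite -finset.in_setC -mem_enum.
by apply: mem_nth; rewrite -cardE cardWC.
Qed.

Lemma place_inr i : place W (inr i) \in W.
Proof. by rewrite -mem_enum; apply: mem_nth; rewrite -cardE cardW. Qed.

Lemma place_bij : bijective (place W).
Proof.
apply: inj_card_bij; last by rewrite card_sum !card_ord.
move=> [i|i] [j|j] E.
- by congr inl; apply: (homo_ltn_ord_inj place_inl_homo).
- by have := place_inl i; rewrite E place_inr.
- by have := place_inl j; rewrite -E place_inr.
- by congr inr; apply: (homo_ltn_ord_inj place_inr_homo).
Qed.

Lemma place_inr_image : [set place W (inr i) | i : 'I_h] = W.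
Proof.
apply/eqP; rewrite eqEcard; apply/andP; split.
  by apply/fintype.subsetP => _ /imsetP[i _ ->]; apply: place_inr.
by rewrite card_imset ?card_ord ?cardW // => i j /(bij_inj place_bij) [].
Qed.

End Place.

(** * The weight recursion for graphs with few pendant appearances *)

Section LowWeight.
Variables (R : realType) (A : graph_family) (hA : iso_closed A).
Variables (lambda nu : R) (hlambda : 0 < lambda) (hnu : 0 < nu).
Variables (h : nat) (h_gt0 : (0 < h)%N) (H : sgraph 'I_h).
Hypothesis hconn : connected_graph H.
Hypothesis hfree : freely_attachable A H (Ordinal h_gt0).
Let root := Ordinal h_gt0.

Definition glue (n : nat) (W : {set 'I_(n + h)}) (G : sgraph 'I_n) (v : 'I_n) :
    sgraph 'I_(n + h) :=
  relabel (place W) (attach G v H root).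

Definition low_graph (n k : nat) (G : sgraph 'I_n) : bool :=
  A G && (pendant_count H G <= k)%N.

Definition low_weight (n k : nat) : R :=
  \sum_(G : sgraph 'I_n | low_graph k G) tau lambda nu G.

Lemma tau_gt0 (T : finType) (G : sgraph T) : 0 < tau lambda nu G.
Proof. by rewrite mulr_gt0 // exprn_gt0. Qed.

Lemma low_weight_ge0 n k : 0 <= low_weight n k.
Proof. by apply: sumr_ge0 => G _; apply/ltW/tau_gt0. Qed.

Lemma low_weight_le n k : low_weight n k <= tau_class A lambda nu n.
Proof.
rewrite /tau_class (bigID (fun G => (pendant_count H G <= k)%N)) /= lerDl.
by apply: sumr_ge0 => G _; apply/ltW/tau_gt0.
Qed.

Section Glue.
Variables (n : nat) (W : {set 'I_(n + h)}).
Hypothesis cardW : #|W| = h.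

Lemma tau_glue (G : sgraph 'I_n) (v : 'I_n) :
  tau lambda nu (glue W G v) = tau lambda nu G * lambda ^+ (num_edges H).+1.
Proof.
have bij := place_bij cardW.
rewrite /tau num_edges_relabel // num_comps_relabel // num_edges_attach.
by rewrite num_comps_attach // -addnS exprD mulrAC.
Qed.

Lemma low_glue (k : nat) (G : sgraph 'I_n) (v : 'I_n) :
  low_graph k G -> low_graph (k + h.+1 ^ 2)%N (glue W G v).
Proof.
have bij := place_bij cardW; case/andP => AG kG; apply/andP; split.
  exact: hA (relabel_iso bij _) (hfree _ AG).
apply: leq_trans _ (leq_add kG (leqnn _)).
exact: (pendant_count_glue h_gt0 hconn G v bij (place_inl_homo cardW)).
Qed.

Lemma pendant_glue (G : sgraph 'I_n) (v : 'I_n) : pendant_at H (glue W G v) W.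
Proof.
rewrite -[X in pendant_at _ _ X](place_inr_image cardW).
apply: pendant_at_glue; first exact: place_bij.
exact: place_inr_homo.
Qed.

(** For fixed [W], the old graph is read off on the old vertices, and the attachment vertex is the
    only old neighbour of the root of the copy. *)
Lemma glue_inj (G G' : sgraph 'I_n) (v v' : 'I_n) :
  glue W G v = glue W G' v' -> G = G' /\ v = v'.
Proof.
have bij := place_bij cardW => E.
have adjE x y : adj (attach G v H root) x y = adj (attach G' v' H root) x y.
  by rewrite -(adj_relabel bij) -[RHS](adj_relabel bij) [relabel _ _]E.
split.
  apply: sgraph_adj_inj => a b; have := adjE (inl a) (inl b).
  by rewrite !adj_attach.
have := adjE (inl v) (inr root); rewrite !adj_attach !eqxx !andbT.
by move/esym/eqP.
Qed.

End Glue.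

(* Double count the pairs of a low graph of order n + h and a pendant
   appearance in it. *)
Lemma low_weight_step (n k : nat) :
  low_weight n k * ('C(n + h, h) * n)%:R * lambda ^+ (num_edges H).+1
    <= low_weight (n + h)%N (k + h.+1 ^ 2)%N * (k + h.+1 ^ 2)%:R.
Proof.
set k' := (k + _)%N.
pose D := [set p : sgraph 'I_n * ({set 'I_(n + h)} * 'I_n) |
  low_graph k p.1 && (p.2.1 \in [set W : {set 'I_(n + h)} | #|W| == h])].
pose Phi (p : sgraph 'I_n * ({set 'I_(n + h)} * 'I_n)) :=
  (glue p.2.1 p.1 p.2.2, p.2.1).
(* Each low graph has ['C(n + h, h)] choices of block and [n] of attachment vertex, and every gluing
   multiplies its weight by the same power of [lambda]. *)
have -> : low_weight n k * ('C(n + h, h) * n)%:R * lambda ^+ (num_edges H).+1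
    = \sum_(p in D) tau lambda nu (Phi p).1.
  transitivity (\sum_(p : sgraph 'I_n * ({set 'I_(n + h)} * 'I_n) |
      low_graph k p.1 &&
      (p.2 \in finset.setX [set W : {set 'I_(n + h)} | #|W| == h] [set: 'I_n]))
    tau lambda nu p.1 * lambda ^+ (num_edges H).+1).
    rewrite -(pair_big (@low_graph n k) (fun q => q \in finset.setX _ _)
      (fun G _ => tau lambda nu G * _)) /=.
    rewrite -mulrA mulr_suml; apply: eq_bigr => G _.
    rewrite sumr_const cardsX card_draws cardsT !card_ord.
    by rewrite mulrCA mulrC mulr_natr mulrC.
  apply: eq_big => [[G [W v]]|[G [W v]] /=]; first by rewrite !inE /= andbT.
  by case/andP => _ /[!inE] /= /andP[/eqP cardW _]; rewrite tau_glue.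
(* [Phi] is injective on [D]: it records the block, and [glue_inj] recovers the rest. *)
rewrite -(big_imset (fun q : sgraph 'I_(n + h) * {set 'I_(n + h)} =>
  tau lambda nu q.1)); last first.
  move=> [G [W v]] [G' [W' v']] /[!inE] /= /andP[_ /eqP cardW] _ E.
  have /= W_E := congr1 snd E; case: W' / W_E E => /(congr1 fst) /=.
  by case/(glue_inj cardW) => -> ->.
apply: (@le_trans _ _ (\sum_(q : sgraph 'I_(n + h) * {set 'I_(n + h)} |
    low_graph k' q.1 && pendant_at H q.1 q.2) tau lambda nu q.1)).
  rewrite [leRHS](bigID (mem (Phi @: D))) /= -[leLHS]addr0 lerD //.
    rewrite le_eqVlt; apply/orP; left; apply/eqP/eq_bigl => q.
    rewrite andb_idl // => /imsetP[[G [W v]] /[!inE] /= /andP[lowG /eqP cardW]].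
    by move=> ->; rewrite /= low_glue // pendant_glue.
  by apply: sumr_ge0 => q _; apply/ltW/tau_gt0.
rewrite -(pair_big_dep (@low_graph (n + h)%N k') (fun G W => pendant_at H G W)
  (fun G _ => tau lambda nu G)) /= mulr_suml.
(* A low graph is counted once per pendant appearance, that is at most [k'] times. *)
apply: ler_sum => G /andP[_ Gk].
rewrite sumr_const -[X in X <= _]mulr_natr ler_pM2l ?tau_gt0 // ler_nat.
by rewrite -[X in (X <= _)%N]cardsE.
Qed.
End LowWeight.

(** * Iterating the recursion *)

Section Iterate.
Variables (R : realType) (A : graph_family) (hA : iso_closed A).
Variables (lambda nu : R) (hlambda : 0 < lambda) (hnu : 0 < nu).
Variables (h : nat) (h_gt0 : (0 < h)%N) (H : sgraph 'I_h).
Hypothesis hconn : connected_graph H.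
Hypothesis hfree : freely_attachable A H (Ordinal h_gt0).

Let weight := low_weight A lambda nu H.
Let K := (h.+1 ^ 2)%N.
Let e := (num_edges H).+1.

(** The constant [c] is a lower bound, valid at every step, for the order times [lambda ^+ e]
    divided by the new appearance bound. The binomial factors telescope to [(n + m * h)!] over [n!]
    times the [m]-th power of [h!]. *)
Lemma low_weight_iter (n k m : nat) (c : R) : 0 <= c ->
  (forall i, (i < m)%N ->
     (k + i.+1 * K)%:R * c <= (n + i * h)%:R * lambda ^+ e) ->
  (n + m * h)`!%:R * c ^+ m * weight n k
    <= weight (n + m * h)%N (k + m * K)%N * h`!%:R ^+ m * n`!%:R.
Proof.
move=> c_ge0; elim: m => [|m IHm] cP.
  by rewrite !mul0n !addn0 !expr0 !mulr1 mulrC.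
have {}IHm := IHm (fun i im => cP i (leqW im)).
have := low_weight_step hA hlambda hnu hconn hfree (n + m * h) (k + m * K).
rewrite -/K -!addnA ![(m * _ + _)%N]addnC -!mulSn.
rewrite -/weight -/e.
set N := (n + m * h)%N in IHm *; set N' := (n + m.+1 * h)%N.
set D := (k + m.+1 * K)%N; set L := weight N _ in IHm *; set L' := weight N' D.
move=> step.
have D_gt0 : 0 < D%:R :> R by rewrite ltr0n addn_gt0 muln_gt0 expn_gt0 orbT.
have L_ge0 : 0 <= L by apply: low_weight_ge0.
have C_ge0 : 0 <= 'C(N', h)%:R :> R by rewrite ler0n.
(* The hypothesis on [c] at index [m] gives [D * c <= N * lambda ^+ e], which allows the factor [D]
   to be cancelled. *)
have {}step : 'C(N', h)%:R * c * L <= L'.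
  rewrite -(ler_pM2r D_gt0); apply: le_trans step; rewrite natrM.
  have := cP m (ltnSn m); rewrite -/N -/D.
  move: L_ge0 C_ge0; clearbody L; clear.
  move: D%:R N%:R 'C(N', h)%:R (lambda ^+ e) => d x C l L_ge0 C_ge0 le1.
  rewrite [leLHS](_ : _ = L * C * (d * c)); last by ring.
  rewrite [leRHS](_ : _ = L * C * (x * l)); last by ring.
  by rewrite ler_wpM2l // mulr_ge0.
have factE : N'`!%:R = 'C(N', h)%:R * h`!%:R * N`!%:R :> R.
  rewrite -!natrM; congr _%:R.
  have <- : (N' - h = N)%N by rewrite /N' mulSn addnCA addKn.
  by rewrite -mulnA bin_fact // /N' mulSn addnCA leq_addr.
rewrite factE !exprS; move: IHm step c_ge0 C_ge0 (ler0n R h`!) (ler0n R n`!).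
move: (weight n k); clearbody L L'; clear.
move: N`!%:R n`!%:R h`!%:R 'C(N', h)%:R (c ^+ m) => N1 n1 h1 C cm L0.
move=> IHm step c_ge0 C_ge0 h1_ge0 n1_ge0; have := exprn_ge0 m h1_ge0.
move: (h1 ^+ m) IHm => hm IHm hm_ge0.
apply: (@le_trans _ _ (C * c * h1 * (L * hm * n1))).
  rewrite [leLHS](_ : _ = C * c * h1 * (N1 * cm * L0)); last by ring.
  by rewrite ler_wpM2l // !mulr_ge0.
rewrite [leLHS](_ : _ = C * c * L * (h1 * hm * n1)); last by ring.
rewrite [leRHS](_ : _ = L' * (h1 * hm * n1)); last by ring.
by rewrite ler_wpM2r // !mulr_ge0.
Qed.
End Iterate.

(** * Comparison with the growth constant *)

Lemma growth_constant_eventually (R : realType) (A : graph_family)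
    (lambda nu gamma eta : R) :
  growth_constant A lambda nu gamma -> 0 < eta ->
  exists N0, forall n, (N0 <= n)%N ->
    exists2 x, `|x - gamma| < eta & tau_class A lambda nu n = x ^+ n * n`!%:R.
Proof.
move=> [_ [eps eps0 epsE]] eta_gt0.
move/cvgr0Pnorm_lt : eps0 => /(_ _ eta_gt0) eps_lt.
have [N0 _ HN] := filterI eps_lt epsE.
exists N0 => n /HN[epsn tauE]; exists (gamma + eps n) => //.
by rewrite addrC addKr.
Qed.

Lemma tau_prob_low_weight (R : realType) (A : graph_family) (lambda nu : R)
    (h : nat) (H : sgraph 'I_h) (n : nat) (x : R) : 0 <= x ->
  tau_prob A lambda nu (fun G : sgraph 'I_n => (pendant_count H G)%:R <= x)
  = low_weight A lambda nu H n (Num.truncn x) / tau_class A lambda nu n.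
Proof.
move=> x_ge0; rewrite /tau_prob /low_weight mulr_suml -big_mkcondr.
by apply: eq_bigl => G; rewrite /low_graph truncn_ge_nat // andbC.
Qed.

(** A single member [G] has positive weight, and gluing repeatedly onto it forces the class weight
    divided by the factorial to be at least a constant times a fixed positive base to the power [m].
    A growth constant 0 contradicts this for large [m]. *)
Lemma growth0_empty (R : realType) (A : graph_family) (lambda nu : R)
    (h : nat) (h_gt0 : (0 < h)%N) (H : sgraph 'I_h)
    (n : nat) (G : sgraph 'I_n) :
  iso_closed A -> 0 < lambda -> 0 < nu -> connected_graph H ->
  freely_attachable A H (Ordinal h_gt0) ->
  growth_constant A lambda nu 0 -> (0 < n)%N -> ~~ A _ G.
Proof.
move=> hA hlambda hnu hconn hfree growth n_gt0; apply/negP => AG.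
pose k := pendant_count H G; pose K := (h.+1 ^ 2)%N.
pose l := lambda ^+ (num_edges H).+1.
have l_gt0 : 0 < l by rewrite exprn_gt0.
have L_gt0 : 0 < low_weight A lambda nu H n k.
  rewrite /low_weight (bigD1 G) /=; last by rewrite /low_graph AG leqnn.
  rewrite ltr_pwDl ?tau_gt0 // sumr_ge0 // => G' _; exact/ltW/tau_gt0.
have kK_gt0 : 0 < (k + K)%:R :> R by rewrite ltr0n addn_gt0 expn_gt0 orbT.
(* This ratio serves every step, because [k + i.+1 * K <= i.+1 * (k + K)] and
   [i.+1 <= n + i * h]. *)
pose c := l / (k + K)%:R.
have c_gt0 : 0 < c by rewrite divr_gt0.
have iter m := low_weight_iter (m := m) hA hlambda hnu hconn hfree (ltW c_gt0)
  (n := n) (k := k).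
have {}iter m : (n + m * h)`!%:R * c ^+ m * low_weight A lambda nu H n k
    <= tau_class A lambda nu (n + m * h)%N * h`!%:R ^+ m * n`!%:R.
  apply: (le_trans (iter m _)) => [i _|].
    rewrite /c mulrCA mulrC ler_wpM2r ?(ltW l_gt0) // ler_pdivrMr //.
    rewrite -natrM ler_nat -/K.
    apply: (@leq_trans (i.+1 * (k + K))).
      by rewrite mulnDr leq_add2r leq_pmull.
    rewrite leq_mul2r; apply/orP; right.
    by rewrite -add1n leq_add // leq_pmulr.
  by rewrite !ler_wpM2r ?exprn_ge0 ?low_weight_le.
have hf_gt0 : 0 < h`!%:R :> R by rewrite ltr0n fact_gt0.
(* The bound 1 lets the exponent [n + m * h] be lowered to [m]; the other bound leaves a spare
   factor 2 per step after [h!] and [c] cancel. *)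
pose q := Num.min 1 (c / (2 * h`!%:R)).
have d_gt0 : 0 < c / (2 * h`!%:R) by rewrite divr_gt0 // mulr_gt0.
have q_gt0 : 0 < q by rewrite lt_min ltr01.
have [N0 tauN] := growth_constant_eventually growth q_gt0.
(* Large enough both to reach the range of [tauN] and to make [2 ^+ m] times the low weight exceed
   [n!]. *)
pose m := (N0 + (Num.truncn (n`!%:R / low_weight A lambda nu H n k)).+1)%N.
have mh : (m <= n + m * h)%N by rewrite (leq_trans _ (leq_addl _ _)) ?leq_pmulr.
have [x xq tauE] := tauN (n + m * h)%N (leq_trans (leq_addr _ _) mh).
rewrite subr0 in xq.
have x_le : x ^+ (n + m * h) <= (c / (2 * h`!%:R)) ^+ m.
  rewrite (le_trans (ler_norm _)) // normrX.
  apply: (@le_trans _ _ (q ^+ (n + m * h))).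
    by rewrite lerXn2r ?nnegrE ?(ltW q_gt0) // ltW.
  apply: (@le_trans _ _ (q ^+ m)).
    by rewrite ler_wiXn2l ?(ltW q_gt0) // /q ge_min lexx.
  rewrite lerXn2r ?nnegrE ?(ltW q_gt0) ?(ltW d_gt0) //.
  by rewrite /q ge_min lexx orbT.
have /negP[] : ~~ (2 ^+ m * low_weight A lambda nu H n k <= n`!%:R).
  rewrite -ltNge -ltr_pdivrMr //.
  have d_ge0 : 0 <= n`!%:R / low_weight A lambda nu H n k.
    by rewrite divr_ge0 // ltW.
  have /andP[_ lt1] := truncn_itv d_ge0.
  apply: (lt_le_trans lt1); rewrite -natrX ler_nat.
  by apply: leq_trans (ltnW (ltn_expl m (ltnSn 1))); rewrite leq_addl.
have := iter m; rewrite tauE.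
have N_gt0 : 0 < (n + m * h)`!%:R :> R by rewrite ltr0n fact_gt0.
rewrite -!mulrA [x ^+ _ * _]mulrCA ler_pM2l // => le1.
have cm_gt0 : 0 < c ^+ m by rewrite exprn_gt0.
rewrite -(ler_pM2l cm_gt0) mulrCA.
have p2_gt0 : 0 < 2 ^+ m :> R by rewrite exprn_gt0.
apply: (le_trans (ler_wpM2l (ltW p2_gt0) le1)).
have P_ge0 : 0 <= h`!%:R ^+ m * n`!%:R :> R by rewrite mulr_ge0 ?exprn_ge0.
apply: (le_trans (ler_wpM2l (ltW p2_gt0) (ler_wpM2r P_ge0 x_le))).
rewrite (expr_div_n c) (exprMn m 2).
have hm_gt0 : 0 < h`!%:R ^+ m :> R by rewrite exprn_gt0.
move: hm_gt0 p2_gt0; clear.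
move: (c ^+ m) (2 ^+ m) (h`!%:R ^+ m) n`!%:R => cm p2 hm nf hm_gt0 p2_gt0.
rewrite le_eqVlt; apply/orP; left; apply/eqP; field.
by rewrite !gt_eqF.
Qed.

(** With about [alpha * n] iterations, each step gains a factor [expR 2] over the growth of the
    whole class, while replacing the base at order [n + m * h] by the one at order [n] costs at most
    [expR (alpha / 2 * n)]. *)
Lemma growth_pos_tail (R : realType) (A : graph_family) (lambda nu gamma : R)
    (h : nat) (h_gt0 : (0 < h)%N) (H : sgraph 'I_h) :
  iso_closed A -> 0 < lambda -> 0 < nu -> connected_graph H ->
  freely_attachable A H (Ordinal h_gt0) ->
  0 < gamma -> growth_constant A lambda nu gamma ->
  exists2 alpha : R, 0 < alpha &
    exp_neg_Omega (fun n : nat =>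
      tau_prob A lambda nu
        (fun G : sgraph 'I_n => (pendant_count H G)%:R <= alpha * n%:R)).
Proof.
move=> hA hlambda hnu hconn hfree gamma_gt0 growth.
pose K := (h.+1 ^ 2)%N; pose l := lambda ^+ (num_edges H).+1.
have l_gt0 : 0 < l by rewrite exprn_gt0.
have hf_gt0 : 0 < h`!%:R :> R by rewrite ltr0n fact_gt0.
(* Chosen so that [alpha * E = expR (-2)] becomes [(2 * gamma) ^+ h * h! = expR (-2) * c] for the
   [c] below. *)
pose E := (2 * gamma) ^+ h * h`!%:R * K.+1%:R / l.
have E_gt0 : 0 < E by rewrite divr_gt0 // !mulr_gt0 // exprn_gt0 // mulr_gt0.
have [alpha alpha_gt0 alphaE] :
    exists2 alpha, 0 < alpha & alpha * E = expR (-2).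
  exists (expR (-2) / E); first exact: divr_gt0 (expR_gt0 _) E_gt0.
  by rewrite divfK // gt_eqF.
pose c := l / (alpha * K.+1%:R).
have aK_gt0 : 0 < alpha * K.+1%:R by rewrite mulr_gt0.
have c_gt0 : 0 < c by rewrite divr_gt0.
(* This [eta] solves [gamma + eta = (gamma - eta) * (1 + alpha / 2)], which bounds the ratio of two
   bases within [eta] of [gamma]. *)
have [eta eta_gt0 etaE] :
    exists2 eta, 0 < eta & eta * (4 + alpha) = gamma * alpha.
  have alpha4_gt0 : 0 < 4 + alpha by rewrite addr_gt0.
  exists (gamma * alpha / (4 + alpha)); first by rewrite divr_gt0 // mulr_gt0.
  by rewrite divfK // gt_eqF.
have eta_lt : eta < gamma.
  by move: gamma_gt0 alpha_gt0 eta_gt0 etaE; clear; nra.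
have [N0 tauN] := growth_constant_eventually growth eta_gt0.
exists alpha => //; exists (alpha / 2); first by rewrite divr_gt0.
(* The second summand ensures [alpha * n >= 2], which absorbs the rounding in [m]. *)
exists (N0 + (Num.truncn (2 / alpha)).+1)%N => // n /= n_ge.
have an_ge2 : 2 <= alpha * n%:R.
  rewrite mulrC -ler_pdivrMr //.
  have d_gt0 : 0 < 2 / alpha by rewrite divr_gt0.
  have /andP[_ /ltW lt1] := truncn_itv (ltW d_gt0).
  apply: (le_trans lt1); rewrite ler_nat; apply: leq_trans n_ge.
  exact: leq_addl.
have an_ge0 : 0 <= alpha * n%:R by apply: le_trans an_ge2.
rewrite tau_prob_low_weight //.
(* The same [m] is the bound on the appearances and the number of iterations. *)
set m := Num.truncn _; set L0 := low_weight _ _ _ _ _ _.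
have /andP[m_le m_gt] := truncn_itv an_ge0; rewrite -/m in m_le m_gt.
have /(low_weight_iter hA hlambda hnu hconn hfree (ltW c_gt0)) : forall i,
    (i < m)%N -> (m + i.+1 * K)%:R * c <= (n + i * h)%:R * l.
  move=> i im; apply: (@le_trans _ _ (n%:R * l)); last first.
    by rewrite ler_wpM2r ?(ltW l_gt0) // ler_nat leq_addr.
  rewrite /c mulrCA mulrC ler_wpM2r ?(ltW l_gt0) // ler_pdivrMr //.
  apply: (@le_trans _ _ (m * K.+1)%:R).
    by rewrite ler_nat mulnS leq_add2l leq_mul2r im orbT.
  by rewrite natrM [leRHS]mulrA ler_wpM2r // mulrC.
rewrite -/L0 => iter.
have nN0 : (N0 <= n)%N by rewrite (leq_trans _ n_ge) ?leq_addr.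
have [y yg ->] := tauN n nN0.
have [x xg tauE] := tauN (n + m * h)%N (leq_trans nN0 (leq_addr _ _)).
have {}iter : c ^+ m * L0 <= x ^+ (n + m * h) * h`!%:R ^+ m * n`!%:R.
  have N_gt0 : 0 < (n + m * h)`!%:R :> R by rewrite ltr0n fact_gt0.
  rewrite -(ler_pM2l N_gt0) mulrA; apply: (le_trans iter).
  rewrite !mulrA !ler_wpM2r ?exprn_ge0 //.
  by rewrite [leRHS]mulrC -tauE low_weight_le.
move: xg yg; rewrite !ltr_norml => /andP[xg1 xg2] /andP[yg1 yg2].
have y_gt0 : 0 < y by move: eta_lt yg1; clear; lra.
have x_gt0 : 0 < x by move: eta_lt xg1; clear; lra.
have xy : x <= y * expR (alpha / 2).
  have := expR_ge1Dx (alpha / 2) => le1.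
  apply: (@le_trans _ _ (y * (1 + alpha / 2))); last by rewrite ler_pM2l.
  by move: alpha_gt0 etaE xg2 yg1; clear; nra.
have cE : x ^+ h * h`!%:R <= expR (-2) * c.
  have -> : expR (-2) * c = (2 * gamma) ^+ h * h`!%:R.
    rewrite -alphaE /c /E; move: ((2 * gamma) ^+ h) (h`!%:R : R) => g f.
    by field; rewrite !gt_eqF // ltr0n.
  have g2_gt0 : 0 < 2 * gamma by rewrite mulr_gt0.
  rewrite ler_wpM2r // lerXn2r ?nnegrE ?(ltW x_gt0) ?(ltW g2_gt0) //.
  by move: eta_lt xg2; clear; lra.
have yn_gt0 : 0 < y ^+ n * n`!%:R.
  by rewrite mulr_gt0 ?exprn_gt0 // ltr0n fact_gt0.
rewrite ler_pdivrMr // -(ler_pM2l (exprn_gt0 m c_gt0)).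
apply: (le_trans iter).
have nf_ge0 : 0 <= n`!%:R :> R by [].
rewrite [leRHS](_ : _ =
    c ^+ m * (expR (- (alpha / 2 * n%:R)) * y ^+ n) * n`!%:R);
  last by rewrite !mulrA.
rewrite ler_wpM2r // exprD mulnC exprM -mulrA -exprMn.
apply: (@le_trans _ _ ((y * expR (alpha / 2)) ^+ n * (expR (-2) * c) ^+ m)).
  have xh_ge0 : 0 <= x ^+ h * h`!%:R by rewrite mulr_ge0 // exprn_ge0 // ltW.
  have ye_ge0 : 0 <= y * expR (alpha / 2) by rewrite mulr_ge0 ?expR_ge0 // ltW.
  have c2_ge0 : 0 <= expR (-2) * c by rewrite mulr_ge0 ?expR_ge0 // ltW.
  have xn_ge0 : 0 <= x ^+ n by rewrite exprn_ge0 // ltW.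
  apply: ler_pM => //; first exact: exprn_ge0.
    by rewrite lerXn2r // nnegrE ltW.
  by rewrite lerXn2r.
clearbody c; rewrite !exprMn -!expRM_natl.
rewrite [leLHS](_ : _ = c ^+ m * y ^+ n *
  (expR (n%:R * (alpha / 2)) * expR (m%:R * -2))); last by ring.
rewrite -expRD [leRHS]mulrCA mulrC.
rewrite ler_wpM2r ?mulr_ge0 ?exprn_ge0 ?(ltW c_gt0) ?(ltW y_gt0) //.
rewrite ler_expR.
(* The exponents compare once [alpha * n <= 2 * m], and indeed
   [2 * m > 2 * alpha * n - 2 >= alpha * n]. *)
move: m_gt an_ge2; rewrite -natr1.
move: (m%:R : R) (n%:R : R); clear => r s.
lra.
Qed.

Theorem theorem2p5 (R : realType) (A : graph_family) (hA : iso_closed A)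
    (lambda nu gamma : R) (hlambda : 0 < lambda) (hnu : 0 < nu)
    (hgrowth : growth_constant A lambda nu gamma)
    (h : nat) (h_gt0 : (0 < h)%N) (H : sgraph 'I_h)
    (hconn : connected_graph H)
    (hfree : freely_attachable A H (Ordinal h_gt0)) :
  exists2 alpha : R, 0 < alpha &
    exp_neg_Omega (fun n : nat =>
      tau_prob A lambda nu
        (fun G : sgraph 'I_n => (pendant_count H G)%:R <= alpha * n%:R)).
Proof.
have := hgrowth.1; rewrite le_eqVlt => /predU1P[gamma0|gamma_gt0]; last first.
  exact: growth_pos_tail hfree gamma_gt0 hgrowth.
(* For growth constant 0 the class has no graph of positive order, so by convention the probability
   is 0 for [n >= 1] and any positive constants serve. *)
rewrite -gamma0 in hgrowth; exists 1 => //; exists 1 => //.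
exists 1%N => // n /= n_gt0.
rewrite /tau_prob big1 ?expR_ge0 // => G _; rewrite /tau_law ifN //.
exact: (growth0_empty G hA hlambda hnu hconn hfree hgrowth n_gt0).
Qed.
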